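(* Let $\mathbb{M}$ be a weight sequence with sequence of quotients $\mathbf{m}=(m_p)_{p\in\mathbb{N}_0}$, and let $\alpha>0$. The following are equivalent: (i) there exists $C>0$ such that $\sum_{k=0}^{p}\frac{(k+1)^{\alpha-1}}{m_k}\le C\frac{(p+1)^{\alpha}}{m_p}$ for all $p\in\mathbb{N}_0$; (ii) there exists $\varepsilon\in(0,\alpha)$ such that $(m_p/p^{\alpha-\varepsilon})_{p\in\mathbb{N}}$ is almost decreasing; (iii) there exists a sequence $\mathbf{h}\simeq\mathbf{m}$ such that $((p+1)^{-\alpha}h_p)_{p\in\mathbb{N}_0}$ is nonincreasing and $\sup_{p\ge1}\frac{h_{2p}}{h_p}<2^{\alpha}$; (iv) $\lim_{k\to\infty}\limsup_{p\to\infty}\frac{m_{kp}}{k^{\alpha}m_p}=0$; (v) there exists $k\in\mathbb{N}$, $k\ge2$, such that $\limsup_{p\to\infty}\frac{m_{kp}}{m_p}<k^{\alpha}$; (vi) for every $\theta\in(0,1)$ there exists $k\in\mathbb{N}$, $k\ge2$, such that $m_{kp}\le\theta k^{\alpha}m_p$ for every $p\in\mathbb{N}$; (vii) $\alpha(\mathbf{m})<\alpha$; (viii) there exists $C>0$ such that $\sum_{k=p+1}^{\infty}\frac{m_k}{(k+1)^{1+\alpha}}\le C\frac{m_p}{(p+1)^{\alpha}}$ for every $p\in\mathbb{N}_0$.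
   Context: A weight sequence is a sequence $\mathbb{M}=(M_p)_{p\in\mathbb{N}_0}$ of positive reals with $M_0=1$, logarithmically convex ($M_p^2\le M_{p-1}M_{p+1}$ for $p\in\mathbb{N}$) and $\lim_{p\to\infty}M_p^{1/p}=\infty$; its quotients are $m_p=M_{p+1}/M_p$. A sequence $(a_p)_{p\in\mathbb{N}}$ is almost decreasing if there is $m>0$ with $m\,a_q\le a_p$ for all $p\le q$. $\mathbf{h}\simeq\mathbf{m}$ means there is $c\ge1$ with $c^{-1}m_p\le h_p\le cm_p$ for all $p$. $\alpha(\mathbf{m})$ is the upper Matuszewska index of the sequence $(m_{p-1})_{p\in\mathbb{N}}$, defined as $\alpha(f)$ for the step function $f(x)=m_{\lfloor x\rfloor-1}$, $x\ge1$, where $\alpha(f):=\inf\{\alpha\in\mathbb{R}:\exists C_\alpha>0\ \forall\Lambda>1,\ \limsup_{x\to\infty}\sup_{\lambda\in[1,\Lambda]}\frac{f(\lambda x)}{\lambda^{\alpha}f(x)}\le C_\alpha\}$ ($\inf\emptyset=\infty$). *)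

(* Defs.v *)
From HB Require Import structures.
From mathcomp Require Import all_boot all_order all_algebra.
From mathcomp Require Import all_classical all_reals all_analysis.
Set Implicit Arguments. Unset Strict Implicit. Unset Printing Implicit Defensive.
Import Order.TTheory GRing.Theory Num.Theory.
Import numFieldNormedType.Exports.
Local Open Scope classical_set_scope.
Local Open Scope ring_scope.

Definition weight_seq (R : realType) (M : nat -> R) : Prop :=
  [/\ M 0%N = 1,
      (forall p, 0 < M p),
      (forall p, (1 <= p)%N -> M p ^+ 2 <= M p.-1 * M p.+1) &
      ((fun p : nat => M p `^ (p%:R)^-1) @ \oo --> +oo)].

Definition quot (R : realType) (M : nat -> R) (p : nat) : R := M p.+1 / M p.

Definition almost_decreasing (R : realType) (a : nat -> R) : Prop :=
  exists c : R, 0 < c /\ forall p q, (1 <= p)%N -> (p <= q)%N -> c * a q <= a p.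

Definition seq_equiv (R : realType) (h m : nat -> R) : Prop :=
  exists c : R, 1 <= c /\ forall p, c^-1 * m p <= h p /\ h p <= c * m p.

Definition upper_matuszewska (R : realType) (f : R -> R) : \bar R :=
  ereal_inf [set a%:E | a in [set a : R | exists C : R, 0 < C /\
    forall L : R, 1 < L ->
      (limf_esup (fun x : R =>
         ereal_sup [set (f (l * x) / (l `^ a * f x))%:E | l in `[1%R, L]%classic])
         (pinfty_nbhs R) <= C%:E)%E]].

(* step function f(x) = m_{floor x - 1}, x >= 1 (values for x < 1 irrelevant) *)
Definition step_fun (R : realType) (m : nat -> R) (x : R) : R :=
  m (Num.truncn x).-1.

(* alpha(m) := upper Matuszewska index of (m_{p-1})_{p in N} *)
Definition alpha_index (R : realType) (m : nat -> R) : \bar R :=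
  upper_matuszewska (step_fun m).

(* Main.v *)
(* Every condition is compared with two properties of the positive nondecreasing
   sequence m: a single dilation estimate m(kp) <= r m(p) for large p, with
   r < k^alpha, and the power bound m(q) <= K ((q+1)/(p+1))^a m(p) for p <= q,
   with a < alpha. Iterating the dilation estimate along k^j p and filling the
   gaps by monotonicity yields the power bound, which gives all the conditions
   but (iii) by direct estimates. Conversely, each of (ii)-(vii) contains a
   dilation estimate.
   For (i) and (viii), put b(p) = m(p)/(p+1)^alpha and let u be the inverse of
   the partial sums in (i), resp. the tails in (viii). Then u is comparable to b,
   and the hypothesis says u(p+1) <= (1 - d/(p+2)) u(p), so that u decays at
   least like p^-d and m grows at most like p^(alpha-d). The sequence
   h(p) = (p+1)^alpha u(p) obtained from (i) is the one needed in (iii). *)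
Require Import Defs.
From HB Require Import structures.
From mathcomp Require Import all_boot all_order all_algebra.
From mathcomp Require Import all_classical all_reals all_analysis.
From mathcomp Require Import zify lra ring.
Import Order.TTheory GRing.Theory Num.Theory.
Import numFieldNormedType.Exports.
Local Open Scope classical_set_scope.
Local Open Scope ring_scope.

(** * Estimates for real powers and for sums of powers *)

Lemma powR_succ_le_expR {R : realType} (d : R) (k : nat) : 0 <= d ->
  k%:R `^ d <= k.+1%:R `^ d * expR (- (d / k.+1%:R)).
Proof.
move=> d0; have k1 : (0 : R) < k.+1%:R by [].
have -> : k%:R = k.+1%:R * (1 - k.+1%:R^-1) :> R.
  by rewrite mulrBr divff ?gt_eqF// mulr1 -(natr1 k) addrK.
have x0 : (0 : R) <= 1 - k.+1%:R^-1 by rewrite subr_ge0 invf_le1 ?ler1n.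
rewrite powRM ?ler0n// ler_wpM2l ?powR_ge0// -mulrN mulrC expRM.
by rewrite ge0_ler_powR ?nnegrE ?expR_ge0// expR_ge1Dx.
Qed.

(** With [y = d / n.+1], one has [1 - y <= exp (- y)] and [(1 + 1 / n.+1)^d <= exp y], and the two
    exponentials cancel. *)
Lemma powR_succ_decay {R : realType} (d : R) (n : nat) : 0 <= d ->
  (1 - d / n.+1%:R) * n.+2%:R `^ d <= n.+1%:R `^ d.
Proof.
move=> d0; have n1 : (0 : R) < n.+1%:R by [].
apply: (@le_trans _ _ (expR (- (d / n.+1%:R)) * n.+2%:R `^ d)).
  by rewrite ler_wpM2r ?powR_ge0// expR_ge1Dx.
rewrite expRN mulrC ler_pdivrMr ?expR_gt0//.
have -> : n.+2%:R = n.+1%:R * (1 + n.+1%:R^-1) :> R.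
  by rewrite mulrDr divff ?gt_eqF// mulr1 natr1.
have x0 : (0 : R) <= 1 + n.+1%:R^-1 by rewrite addr_ge0.
rewrite powRM ?ler0n// ler_wpM2l ?powR_ge0// mulrC expRM.
by rewrite ge0_ler_powR ?nnegrE ?expR_ge0// expR_ge1Dx.
Qed.

Lemma powR_predr {R : realType} (d x : R) : 0 < x -> x `^ (d - 1) = x `^ d / x.
Proof. by move=> x0; rewrite powRB ?(lt0r_neq0 x0) ?implybT// powRr1// ltW. Qed.

Lemma sum_powR_le {R : realType} (d : R) (p : nat) : 0 < d ->
  \sum_(k < p.+1) k.+1%:R `^ (d - 1) <= (1 + d) / d * p.+1%:R `^ d.
Proof.
move=> d0; have d10 : 0 < 1 + d by rewrite addr_gt0.
rewrite -ler_pdivrMl ?divr_gt0// invf_div mulr_sumr.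
(* Telescoping: with [y = d / k.+1 <= d], [exp (- y) <= 1 / (1 + y) <= 1 - y / (1 + d)]. This treats
   [d < 1] and [d >= 1] alike. *)
have step (k : nat) :
    d / (1 + d) * k.+1%:R `^ (d - 1) <= k.+1%:R `^ d - k%:R `^ d.
  have k1 : (0 : R) < k.+1%:R by [].
  rewrite lerBrDr -lerBrDl (le_trans (powR_succ_le_expR d k (ltW d0)))//.
  rewrite powR_predr// [leRHS](_ : _ = k.+1%:R `^ d *
    (1 - d / (1 + d) / k.+1%:R)); last by field; rewrite !gt_eqF.
  rewrite ler_wpM2l ?powR_ge0// expRN.
  set y := d / k.+1%:R.
  have y0 : 0 <= y by rewrite divr_ge0// ltW.
  have yd : y <= d by rewrite ler_pdivrMr// ler_peMr ?ler1n// ltW.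
  apply: (@le_trans _ _ (1 + y)^-1).
    by rewrite lef_pV2 ?posrE ?expR_gt0 ?expR_ge1Dx// ltr_pwDl.
  have -> : d / (1 + d) / k.+1%:R = y / (1 + d) by rewrite /y mulrAC.
  have -> : (1 + y)^-1 = 1 - y / (1 + y) by field; rewrite gt_eqF ?ltr_pwDl.
  rewrite lerD2l lerN2 ler_wpM2l// lef_pV2 ?posrE ?ltr_pwDl ?(ltW d0)//.
  by rewrite lerD2l.
elim: p => [|p IH].
  by rewrite big_ord1 (le_trans (step 0%N))// powR0 ?gt_eqF// subr0.
rewrite big_ord_recr/=; apply: le_trans (lerD IH (step _)) _.
by rewrite subrKC.
Qed.

Lemma bernoulli_sub {R : realType} (x : R) (n : nat) : 0 <= x <= 1 ->
  1 - n%:R * x <= (1 - x) ^+ n.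
Proof.
move=> /andP[x0 x1]; elim: n => [|n IH]; first by rewrite mul0r subr0 expr0.
rewrite exprSr; apply: le_trans (ler_wpM2r _ IH); last by rewrite subr_ge0.
rewrite -(natr1 n); have : 0 <= n%:R * x * x by rewrite !mulr_ge0.
by lra.
Qed.

Lemma sum_powR_ge {R : realType} (d : R) : 0 < d -> exists c : R, 0 < c /\
  forall p : nat, p.+1%:R `^ d <= c * \sum_(k < p.+1) k.+1%:R `^ (d - 1).
Proof.
move=> d0; pose N := (Num.truncn d).+1; exists N%:R; split => // p.
(* With [x = 1 / k.+1], Bernoulli gives [1 - N x <= (1 - x)^N <= (1 - x)^d], since [N >= d] and the
   base is at most 1. The base vanishes for [k = 0], which is treated apart. *)
have step (k : nat) :
    k.+1%:R `^ d - k%:R `^ d <= N%:R * k.+1%:R `^ (d - 1).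
  have k1 : (0 : R) < k.+1%:R by [].
  have x01 : 0 <= (k.+1%:R^-1 : R) <= 1.
    by rewrite invr_ge0 ler0n/= invf_le1 ?ler1n.
  rewrite powR_predr// lerBlDr -lerBlDl.
  rewrite [leLHS](_ : _ = k.+1%:R `^ d * (1 - N%:R * k.+1%:R^-1)); last by ring.
  have kE : k%:R = k.+1%:R * (1 - k.+1%:R^-1) :> R.
    by rewrite mulrBr divff ?gt_eqF// mulr1 -(natr1 k) addrK.
  rewrite [in leRHS]kE.
  have y0 : (0 : R) <= 1 - k.+1%:R^-1 by rewrite subr_ge0; case/andP: x01.
  rewrite powRM ?ler0n// ler_wpM2l ?powR_ge0//.
  apply: le_trans (bernoulli_sub _ N x01) _.
  move: y0; rewrite le_eqVlt => /predU1P[<-|y0].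
    by rewrite expr0n/= powR_ge0.
  rewrite -(powR_mulrn N (ltW y0)); apply: (@ger_powR _ (1 - k.+1%:R^-1)).
    by rewrite y0 gerBl invr_ge0 ler0n.
  by rewrite ltW// truncnS_gt.
rewrite mulr_sumr; elim: p => [|p IH].
  by have := step 0%N; rewrite powR0 ?gt_eqF// subr0 big_ord1.
by rewrite big_ord_recr/= -(subrKC (p.+1%:R `^ d) (p.+2%:R `^ d)) lerD.
Qed.

(** The sum is compared with the telescoping sum of [k^-d - k.+1^-d]; with [y = d / k.+1] this rests
    on [(1 + y) exp (- y) <= 1]. *)
Lemma sum_powRN_le {R : realType} (d : R) (p n : nat) : 0 < d ->
  \sum_(p.+1 <= k < n) k.+1%:R `^ (- d - 1) <= d^-1 * p.+1%:R `^ (- d).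
Proof.
move=> d0; rewrite -ler_pdivrMl ?invr_gt0// invrK.
have [np|pn] := leqP n p.+1.
  by rewrite big_geq// mulr0 powR_ge0.
suff : d * (\sum_(p.+1 <= k < n) k.+1%:R `^ (- d - 1)) <=
       p.+1%:R `^ (- d) - n%:R `^ (- d).
  by move=> /le_trans; apply; rewrite gerBl powR_ge0.
have := telescope_sumr (fun k : nat => - k%:R `^ (- d) : R) (ltnW pn).
rewrite opprK addrC => <-; rewrite mulr_sumr; apply: ler_sum_nat => k /andP[pk _].
have k0 : (0 : R) < k%:R by rewrite ltr0n (leq_ltn_trans _ pk).
have k1 : (0 : R) < k.+1%:R by [].
rewrite opprK [leRHS]addrC lerBrDr powR_predr//.
rewrite [leLHS](_ : _ = k.+1%:R `^ (- d) * (1 + d / k.+1%:R)); last first.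
  by ring.
rewrite !powRN mulrC ler_pdivrMr ?powR_gt0// [leRHS]mulrC ler_pdivlMr ?powR_gt0//.
rewrite (le_trans (ler_wpM2l _ (powR_succ_le_expR d k (ltW d0))))//.
  by rewrite addr_ge0// divr_ge0// ltW.
rewrite mulrCA ler_piMr ?powR_ge0// expRN ler_pdivrMr ?expR_gt0// mul1r.
exact: expR_ge1Dx.
Qed.

Lemma powR_gt_near {R : realType} (d K : R) : 0 < d ->
  exists N : nat, forall k : nat, (N <= k)%N -> K < k%:R `^ d.
Proof.
move=> d0; pose B : R := Num.max K 1.
have B0 : 0 < B by rewrite lt_max ltr01 orbT.
exists (Num.truncn (B `^ d^-1)).+1 => k Nk.
have Bk : B `^ d^-1 < k%:R.
  by rewrite (lt_le_trans (truncnS_gt _))// ler_nat.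
apply: (@le_lt_trans _ _ B); first by rewrite le_max lexx.
have BE : (B `^ d^-1) `^ d = B.
  by rewrite -powRrM mulVf ?(lt0r_neq0 d0)// powRr1// ltW.
by rewrite -[ltLHS]BE gt0_ltr_powR ?nnegrE ?powR_ge0.
Qed.

Lemma powR_ln_div {R : realType} (x r : R) : 1 < x -> 0 < r ->
  x `^ (ln r / ln x) = r.
Proof.
move=> x1 r0; have x0 : 0 < x by rewrite (lt_trans ltr01).
by rewrite /powR gt_eqF// divfK ?lnK ?posrE// gt_eqF ?ln_gt0.
Qed.

(** * Dilation bounds and power bounds *)

Definition dilation_bound {R : realType} (m : nat -> R) (alpha : R) : Prop :=
  exists (k : nat) (r : R), [/\ (2 <= k)%N, r < k%:R `^ alpha &
    \forall p \near \oo, m (k * p)%N <= r * m p].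

(** The shift by one keeps the powers positive, so that [p = 0] is included. *)
Definition power_bound {R : realType} (m : nat -> R) (alpha : R) : Prop :=
  exists a K : R, [/\ 0 < a < alpha, 0 < K &
    forall p q, (p <= q)%N ->
      m q * p.+1%:R `^ a <= K * (q.+1%:R `^ a * m p)].

Lemma iter_dilation {R : realType} (m : nat -> R) (k N : nat) (r : R) :
  (1 <= k)%N -> 0 <= r ->
  (forall p, (N <= p)%N -> m (k * p)%N <= r * m p) ->
  forall j p, (N <= p)%N -> m (k ^ j * p)%N <= r ^+ j * m p.
Proof.
move=> k1 r0 kr; elim=> [|j IH] p Np; first by rewrite mul1n mul1r.
rewrite expnS -mulnA; apply: le_trans (kr _ _) _.
  by rewrite (leq_trans Np)// leq_pmull// expn_gt0 k1.
by rewrite exprS -mulrA ler_wpM2l// IH.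
Qed.

Lemma dilation_power_bound {R : realType} (m : nat -> R) (alpha : R) :
  (forall p, 0 < m p) -> {homo m : p q / (p <= q)%N >-> p <= q} -> 0 < alpha ->
  dilation_bound m alpha -> power_bound m alpha.
Proof.
move=> m0 m_nd alpha0 [k] [r] [k2 rk [N _ HN]].
have k1 : (1 : R) < k%:R by rewrite ltr1n.
have k0 : (0 : R) < k%:R by rewrite (lt_trans ltr01).
have r0 : 0 < r.
  by rewrite -(pmulr_lgt0 _ (m0 N)) (lt_le_trans (m0 (k * N)%N))// HN/=.
(* The exponent [ln r / ln k] solves [k^a = r] and lies below [alpha]; the maximum with [alpha / 2]
   keeps [a] positive when [r <= 1]. *)
pose a := Num.max (alpha / 2) (ln r / ln k%:R).
have a0 : 0 < a by rewrite lt_max divr_gt0.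
have aalpha : a < alpha.
  rewrite gt_max ltr_pdivrMr ?ltr_pdivrMr ?ln_gt0// ltr_pMr// ltr1n/=.
  by rewrite -ln_powR ltr_ln ?posrE ?powR_gt0.
have rka : r <= k%:R `^ a.
  rewrite -[leLHS](powR_ln_div _ _ k1 r0); apply: (ler_powR (ltW k1)).
  by rewrite /a le_max lexx orbT.
have iterk j p : (N <= p)%N -> m (k ^ j * p)%N <= (k%:R `^ a) ^+ j * m p.
  move=> Np; apply: (@iter_dilation _ _ _ N); rewrite ?powR_ge0 ?(ltnW k2)//.
  by move=> i Ni; rewrite (le_trans (HN _ Ni))// ler_wpM2r// ltW.
pose p0 := N.+1; pose C : R := k%:R `^ a * 2 `^ a.
have C0 : 0 < C by rewrite mulr_gt0 ?powR_gt0.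
have large p q : (p0 <= p)%N -> (p <= q)%N ->
    m q * p.+1%:R `^ a <= C * (q.+1%:R `^ a * m p).
  move=> p0p pq; have pp : (0 < p)%N by apply: leq_trans p0p.
  have qp : (0 < q %/ p)%N by rewrite divn_gt0.
  (* Here [k^j p <= q < k^(j+1) p]. Rounding [q] up to [k^(j+1) p] costs the factor [k^a] of [C],
     and [p.+1 <= 2 p] costs [2^a]. *)
  have /andP[kq qk] := trunc_log_bounds k2 qp.
  set j := trunc_log _ _ in kq qk.
  rewrite leq_divRL// in kq; rewrite ltn_divLR// in qk.
  have mq : m q <= (k%:R `^ a) ^+ j.+1 * m p.
    by apply: le_trans (iterk _ _ (ltnW p0p)); apply/m_nd/ltnW.
  apply: le_trans (ler_wpM2r (powR_ge0 _ _) mq) _.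
  rewrite mulrAC mulrA ler_wpM2r ?(ltW (m0 p))// exprS /C -!mulrA.
  rewrite ler_wpM2l ?powR_ge0// -powR_mulrn ?powR_ge0// powRAC.
  rewrite -!powRM ?powR_ge0 ?ler0n// ge0_ler_powR ?nnegrE ?mulr_ge0 ?powR_ge0//.
    exact: ltW.
  rewrite powR_mulrn ?ler0n// -natrX -!natrM ler_nat.
  apply: (@leq_trans (k ^ j * (2 * p))).
    by rewrite leq_mul2l mul2n -addnn -addn1 leq_add2l pp orbT.
  by rewrite mulnCA leq_mul2l/= (leq_trans kq).
pose D := m p0 / m 0%N.
have D1 : 1 <= D by rewrite ler_pdivlMr// mul1r m_nd.
exists a, (C * p0.+1%:R `^ a * D); split; first by rewrite a0.
  by rewrite !mulr_gt0 ?powR_gt0// invr_gt0.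
(* Small indices are raised to [p0]: [D] pays for replacing [m p] by [m p'], and [p0.+1^a] pays for
   [q'.+1 <= p0.+1 * q.+1]. *)
move=> p q pq; pose p' := maxn p p0; pose q' := maxn q p0.
have p'q' : (p' <= q')%N by rewrite geq_max !leq_max pq leqnn/= orbT.
have mp' : m p' <= D * m p.
  rewrite /p'; case: (leqP p p0) => [pp0|_].
    by rewrite /D mulrAC ler_pdivlMr// ler_wpM2l ?m_nd// ltW.
  by rewrite ler_peMl// ltW.
have h : m q * p.+1%:R `^ a <= m q' * p'.+1%:R `^ a.
  apply: ler_pM; rewrite ?powR_ge0 ?(ltW (m0 _))//.
    by rewrite m_nd// leq_maxl.
  by rewrite ge0_ler_powR ?nnegrE ?ler0n ?(ltW a0)// ler_nat ltnS leq_maxl.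
apply: (le_trans h); apply: le_trans (large _ _ (leq_maxr _ _) p'q') _.
rewrite [leRHS](_ : _ = C * ((p0.+1%:R * q.+1%:R) `^ a * (D * m p))); last first.
  by rewrite powRM ?ler0n//; ring.
rewrite ler_wpM2l ?(ltW C0)//.
apply: ler_pM => //; rewrite ?powR_ge0 ?(ltW (m0 _))//.
rewrite ge0_ler_powR ?nnegrE ?mulr_ge0 ?ler0n ?(ltW a0)// -natrM ler_nat.
rewrite /q'; case: (leqP q p0) => _.
  by rewrite leq_pmulr.
by rewrite leq_pmull.
Qed.

(** Any constant [K] is harmless when [k] may be taken large: [k^(alpha - a)] eventually exceeds
    [K], so [r = K k^a] is admissible. *)
Lemma cofinal_dilation_bound {R : realType} (m : nat -> R) (alpha a K : R) :
  (forall p, 0 < m p) -> a < alpha ->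
  (forall n : nat, exists k : nat, (n <= k)%N /\
    \forall p \near \oo, m (k * p)%N <= K * k%:R `^ a * m p) ->
  dilation_bound m alpha.
Proof.
move=> m0 aalpha mK.
have d0 : 0 < alpha - a by rewrite subr_gt0.
have [N HN] := powR_gt_near _ K d0.
have [k [Nk mk]] := mK (maxn N 2).
move: Nk; rewrite geq_max => /andP[Nk k2].
have k0 : (0 : R) < k%:R by rewrite ltr0n (leq_trans _ k2).
exists k, (K * k%:R `^ a); split => //.
rewrite -ltr_pdivlMr ?powR_gt0// -powRB; first exact: HN.
by rewrite (lt0r_neq0 k0) implybT.
Qed.

(** * Sequences with power decay *)

Lemma decay_powR {R : realType} (u : nat -> R) (d : R) : 0 <= d ->
  (forall p, 0 < u p) ->
  (forall p, u p.+1 <= (1 - d / p.+2%:R) * u p) ->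
  forall p q, (p <= q)%N -> u q * q.+2%:R `^ d <= u p * p.+2%:R `^ d.
Proof.
move=> d0 u0 ud p q; elim: q => [|q IH].
  by rewrite leqn0 => /eqP->.
rewrite leq_eqVlt => /predU1P[<-//|/IH]; apply: le_trans.
apply: le_trans (ler_wpM2r (powR_ge0 _ _) (ud q)) _.
by rewrite mulrAC mulrC ler_wpM2l ?(ltW (u0 _))// powR_succ_decay.
Qed.

(** From [p] to [k p], [u] loses a factor of order [k^-d] while the weight gains [k^alpha], so [m]
    grows by at most a constant times [k^(alpha - d)]. *)
Lemma decay_dilation_bound {R : realType} (m u : nat -> R) (alpha d c1 c2 : R) :
  (forall p, 0 < m p) -> 0 <= alpha -> 0 < d -> 0 < c1 -> 0 < c2 ->
  (forall p, 0 < u p) ->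
  (forall p, u p.+1 <= (1 - d / p.+2%:R) * u p) ->
  (forall p, c1 * u p <= m p / p.+1%:R `^ alpha) ->
  (forall p, m p / p.+1%:R `^ alpha <= c2 * u p) ->
  dilation_bound m alpha.
Proof.
move=> m0 alpha0 d0 c10 c20 u0 ud um mu.
apply: (@cofinal_dilation_bound _ _ _ (alpha - d) (c2 / c1 * 3 `^ d)) => //.
  by rewrite gtrBl.
move=> n; exists n.+1; split => //; exists 1%N => // p p1.
set k := n.+1.
have k0 : (0 : R) < k%:R by [].
have pkp : (p <= k * p)%N by rewrite leq_pmull.
(* The 3 comes from [(p + 2) / (k p + 2) <= 3 / k], valid for [p >= 1]. *)
have ukp : u (k * p)%N <= u p * (3 / k%:R) `^ d.
  have := decay_powR _ _ (ltW d0) u0 ud _ _ pkp.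
  rewrite -ler_pdivlMr ?powR_gt0// => /le_trans; apply.
  rewrite -mulrA ler_wpM2l ?(ltW (u0 _))// ler_pdivrMr ?powR_gt0//.
  rewrite -powRM ?ler0n ?divr_ge0// ge0_ler_powR ?nnegrE ?mulr_ge0 ?(ltW d0)//.
  rewrite mulrAC ler_pdivlMr// -!natrM ler_nat.
  have := leq_pmulr k p1; lia.
have := mu (k * p)%N; rewrite ler_pdivrMr ?powR_gt0// => /le_trans; apply.
rewrite powRB ?(lt0r_neq0 k0) ?implybT//.
apply: (@le_trans _ _ (c2 * (u p * (3 / k%:R) `^ d) * (k * p).+1%:R `^ alpha)).
  by rewrite ler_wpM2r ?powR_ge0// ler_wpM2l// ltW.
apply: (@le_trans _ _
    (c2 * (u p * (3 / k%:R) `^ d) * (k%:R `^ alpha * p.+1%:R `^ alpha))).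
  rewrite ler_wpM2l ?mulr_ge0 ?powR_ge0 ?(ltW c20) ?(ltW (u0 _))//.
  rewrite -powRM ?ler0n// ge0_ler_powR ?nnegrE ?mulr_ge0// -natrM ler_nat.
  by rewrite mulnS -add1n leq_add2r.
have h : u p * p.+1%:R `^ alpha <= c1^-1 * m p.
  by rewrite ler_pdivlMl// mulrA -ler_pdivlMr ?powR_gt0.
rewrite powRM ?ler0n ?invr_ge0// -powR_inv1 ?ler0n// -powRrM mulN1r powRN.
rewrite [leLHS](_ : _ = c2 * 3 `^ d * (k%:R `^ d)^-1 * k%:R `^ alpha *
  (u p * p.+1%:R `^ alpha)); last by ring.
rewrite [leRHS](_ : _ = c2 * 3 `^ d * (k%:R `^ d)^-1 * k%:R `^ alpha *
  (c1^-1 * m p)); last by ring.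
by rewrite ler_wpM2l ?mulr_ge0 ?invr_ge0 ?powR_ge0 ?(ltW c20).
Qed.

(** * Limits superior in the extended reals *)

Lemma lte_EFin_le {R : realType} (y : \bar R) (x : R) : (y < x%:E)%E ->
  exists r : R, r < x /\ (y <= r%:E)%E.
Proof.
case: y => [r|//|_]; first by rewrite lte_fin => rx; exists r.
by exists (x - 1); rewrite gtrBl ltr01 leNye.
Qed.

Lemma limf_esup_lt {R : realType} {T : choiceType} {X : filteredType T}
  (f : X -> \bar R) (F : set_system X) {FF : Filter F} (x : R) :
  (limf_esup f F < x%:E)%E ->
  exists r : R, r < x /\ \forall t \near F, (f t <= r%:E)%E.
Proof.
rewrite limf_esupE => /ereal_inf_lt[_ [V FV <-]] /lte_EFin_le[r [rx Vr]].
exists r; split => //; apply: filterS FV => t Vt.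
by apply: le_trans Vr; apply: ereal_sup_ubound; exists t.
Qed.

Lemma limf_esup_le {R : realType} {T : choiceType} {X : filteredType T}
  (f : X -> \bar R) (F : set_system X) (y : \bar R) :
  (\forall t \near F, (f t <= y)%E) -> (limf_esup f F <= y)%E.
Proof.
move=> Fy; rewrite limf_esupE; apply: le_trans (ereal_inf_lbound _) _.
  by exists [set t | (f t <= y)%E].
by apply: ge_ereal_sup => _ [t /= ty <-].
Qed.

(** * Decaying comparison sequences and conditions (i) and (iii) *)

(* The decay condition makes [u p * p.+2%:R `^ d] nonincreasing; the inverted
   partial sums of (i) and the tails of (viii) both give such a [u]. *)
Definition decaying_equiv {R : realType} (m : nat -> R) (alpha : R) : Prop :=
  exists (u : nat -> R) (d c1 c2 : R), [/\ 0 < d, 0 < c1, 0 < c2 &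
    forall p, [/\ 0 < u p, u p.+1 <= (1 - d / p.+2%:R) * u p,
      c1 * u p <= m p / p.+1%:R `^ alpha &
      m p / p.+1%:R `^ alpha <= c2 * u p]].

Lemma decaying_dilation_bound {R : realType} (m : nat -> R) (alpha : R) :
  (forall p, 0 < m p) -> 0 < alpha ->
  decaying_equiv m alpha -> dilation_bound m alpha.
Proof.
move=> m0 alpha0 [u [d [c1 [c2 [d0 c10 c20 uP]]]]].
by apply: (@decay_dilation_bound _ m u alpha d c1 c2) => //;
  try (move=> p; case: (uP p)); rewrite // ltW.
Qed.

Lemma sum_decaying_equiv {R : realType} (m : nat -> R) (alpha C : R) :
  (forall p, 0 < m p) -> {homo m : p q / (p <= q)%N >-> p <= q} ->
  0 < alpha -> 0 < C ->
  (forall p : nat, \sum_(k < p.+1) (k.+1%:R `^ (alpha - 1) / m k)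
     <= C * (p.+1%:R `^ alpha / m p)) ->
  decaying_equiv m alpha.
Proof.
move=> m0 m_nd alpha0 C0 mC.
pose S p := \sum_(k < p.+1) (k.+1%:R `^ (alpha - 1) / m k).
have t0 k : 0 < k.+1%:R `^ (alpha - 1) / m k by rewrite divr_gt0 ?powR_gt0.
have S0 p : 0 < S p.
  by rewrite /S big_ord_recr/= ltr_wpDl// sumr_ge0// => k _; exact: ltW.
have [c [c0 Hc]] := sum_powR_ge _ alpha0.
have bE p : m p / p.+1%:R `^ alpha = (p.+1%:R `^ alpha / m p)^-1.
  by rewrite invf_div.
have b0 p : 0 < p.+1%:R `^ alpha / m p by rewrite divr_gt0 ?powR_gt0.
(* The hypothesis at [p.+1] bounds the increment of [S] below by [S p.+1 / (C * p.+2)], whence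
   [d = 1 / C]. The constant [c] comes from [m k <= m p] inside the sum, and [C] is the hypothesis
   at [p]. *)
exists (fun p => (S p)^-1), C^-1, c^-1, C; split; rewrite ?invr_gt0// => p.
split; rewrite ?invr_gt0//.
- rewrite -ler_pdivrMr ?invr_gt0// invrK mulrC ler_pdivrMr// mulrC.
  have SS : S p.+1 = S p + p.+2%:R `^ (alpha - 1) / m p.+1.
    by rewrite /S big_ord_recr.
  suff : S p.+1 * (C^-1 / p.+2%:R) <= p.+2%:R `^ (alpha - 1) / m p.+1.
    by move=> le_s; rewrite mulrBr mulr1 lerBrDr [leRHS]SS lerD2l.
  rewrite powR_predr// mulrA [leRHS]mulrAC ler_wpM2r ?invr_ge0//.
  by rewrite ler_pdivrMr// mulrC; exact: mC.
- rewrite bE -invfM lef_pV2 ?posrE ?mulr_gt0 ?invr_gt0 ?powR_gt0//.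
  rewrite ler_pdivrMr// (le_trans (Hc p))// -mulrA ler_wpM2l ?(ltW c0)//.
  rewrite /S mulr_suml ler_sum// => k _.
  by rewrite -mulrA ler_peMr ?powR_ge0// ler_pdivlMl// mulr1 m_nd// -ltnS.
- by rewrite bE ler_pdivlMr// ler_pdivrMl// mulrC; exact: mC.
Qed.

Lemma decaying_comparison {R : realType} (m : nat -> R) (alpha : R) :
  (forall p, 0 < m p) -> 0 < alpha -> decaying_equiv m alpha ->
  exists h : nat -> R, seq_equiv h m /\
    (forall p : nat, p.+2%:R `^ (- alpha) * h p.+1
                     <= p.+1%:R `^ (- alpha) * h p) /\
    (ereal_sup [set (h (2 * p)%N / h p)%:E | p in [set p : nat | (1 <= p)%N]]
      < (2 `^ alpha)%:E)%E.
Proof.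
move=> m0 alpha0 [u [d [c1 [c2 [d0 c10 c20 uP]]]]].
have u0 p : 0 < u p by case: (uP p).
have ud p : u p.+1 <= (1 - d / p.+2%:R) * u p by case: (uP p).
pose h p := p.+1%:R `^ alpha * u p.
have h0 p : 0 < h p by rewrite mulr_gt0 ?powR_gt0.
have hE p : p.+1%:R `^ (- alpha) * h p = u p.
  by rewrite powRN mulKf// gt_eqF ?powR_gt0.
exists h; split; [|split].
- pose c := Num.max 1 (Num.max c2 c1^-1).
  have c1' : 1 <= c by rewrite le_max lexx.
  exists c; split => // p; have [_ _ um mu] := uP p; split.
    rewrite ler_pdivrMl ?(lt_le_trans ltr01)//.
    apply: (@le_trans _ _ (c2 * h p)).
      by rewrite mulrCA -ler_pdivrMl ?powR_gt0// mulrC.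
    by rewrite ler_wpM2r ?(ltW (h0 p))// !le_max lexx orbT.
  apply: (@le_trans _ _ (c1^-1 * m p)).
    by rewrite ler_pdivlMl// mulrCA mulrC -ler_pdivlMr ?powR_gt0.
  by rewrite ler_wpM2r ?(ltW (m0 p))// !le_max lexx !orbT.
- move=> p; rewrite !hE (le_trans (ud p))// ler_piMl ?(ltW (u0 p))//.
  by rewrite gerBl divr_ge0 ?ltW.
(* A strict supremum needs a bound uniform in [p]: for [p >= 1], [(p + 2) / (2 p + 2) <= 3 / 4] and
   [2 p + 1 <= 2 (p + 1)]. *)
- apply: (@le_lt_trans _ _ (2 `^ alpha * (3 / 4) `^ d)%:E); last first.
    rewrite lte_fin gtr_pMr ?powR_gt0//.
    have : (3 / 4 : R) `^ d < 1 `^ d by rewrite gt0_ltr_powR ?nnegrE//; lra.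
    by rewrite powR1.
  apply: ge_ereal_sup => _ [p /= p1 <-]; rewrite lee_fin ler_pdivrMr//.
  have up : u (2 * p)%N <= (3 / 4) `^ d * u p.
    have p2p : (p <= 2 * p)%N by rewrite leq_pmull.
    have := decay_powR _ _ (ltW d0) u0 ud _ _ p2p.
    rewrite -ler_pdivlMr ?powR_gt0// => /le_trans; apply.
    rewrite -mulrA mulrC ler_wpM2r ?(ltW (u0 _))// ler_pdivrMr ?powR_gt0//.
    rewrite -powRM// ge0_ler_powR ?nnegrE ?mulr_ge0 ?(ltW d0)//.
    by rewrite mulrAC ler_pdivlMr// -!natrM ler_nat; lia.
  rewrite /h -mulrA [leRHS](_ : _ = 2 `^ alpha * p.+1%:R `^ alpha *
    ((3 / 4) `^ d * u p)); last by ring.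
  apply: ler_pM; rewrite ?powR_ge0 ?(ltW (u0 _))//.
  rewrite -powRM// ge0_ler_powR ?nnegrE ?mulr_ge0 ?(ltW alpha0)//.
  by rewrite -natrM ler_nat; lia.
Qed.

(** * Dilation bounds from conditions (ii), (iii) and (v) *)

(** Passing from [h] to [m] costs [c^2], which may spoil the estimate for the factor 2. Iterating
    first gives [c^2 (2^n)^a] with [a = log_2 r < alpha], and large [n] absorbs [c^2]. *)
Lemma comparison_dilation_bound {R : realType} (m h : nat -> R) (alpha : R) :
  (forall p, 0 < m p) -> seq_equiv h m ->
  (ereal_sup [set (h (2 * p)%N / h p)%:E | p in [set p : nat | (1 <= p)%N]]
    < (2 `^ alpha)%:E)%E ->
  dilation_bound m alpha.
Proof.
move=> m0 [c [c1 hm]] /lte_EFin_le[r [rlt hr]].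
have c0 : 0 < c by rewrite (lt_le_trans ltr01).
have h0 p : 0 < h p.
  by rewrite (lt_le_trans _ (hm p).1)// mulr_gt0 ?invr_gt0.
have h2 p : (1 <= p)%N -> h (2 * p)%N <= r * h p.
  move=> p1; rewrite -ler_pdivrMr// -lee_fin.
  by apply: le_trans hr; apply: ereal_sup_ubound; exists p.
have r0 : 0 < r by rewrite -(pmulr_lgt0 _ (h0 1%N)) (lt_le_trans _ (h2 1%N _)).
have l2 : (1 : R) < 2 by rewrite ltr1n.
have rE := powR_ln_div _ _ l2 r0; set a := ln r / _ in rE.
have aalpha : a < alpha.
  by rewrite ltr_pdivrMr ?ln_gt0// -ln_powR ltr_ln ?posrE ?powR_gt0.
apply: (@cofinal_dilation_bound _ _ _ a (c * c)) => // n.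
exists (2 ^ n)%N; split; first exact/ltnW/ltn_expl.
exists 1%N => // p /= p1.
apply: (@le_trans _ _ (c * h (2 ^ n * p)%N)).
  by rewrite -ler_pdivrMl//; case: (hm (2 ^ n * p)%N).
rewrite -!mulrA ler_wpM2l ?(ltW c0)//.
apply: le_trans (@iter_dilation _ h 2 1 r _ (ltW r0) h2 n p p1) _ => //.
rewrite natrX -(powR_mulrn n (ler0n R 2)) powRAC powR_mulrn ?powR_ge0// rE.
rewrite mulrCA ler_wpM2l ?exprn_ge0 ?(ltW r0)//.
by case: (hm p).
Qed.

Lemma almost_decreasing_dilation_bound {R : realType} (m : nat -> R)
    (alpha a : R) : (forall p, 0 < m p) -> a < alpha ->
  almost_decreasing (fun p : nat => m p / p%:R `^ a) ->
  dilation_bound m alpha.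
Proof.
move=> m0 aalpha [c [c0 cm]].
apply: (@cofinal_dilation_bound _ _ _ a c^-1) => // n.
exists n.+1; split => //; exists 1%N => // p /= p1.
have p0 : (0 : R) < p%:R by rewrite ltr0n.
have := cm p (n.+1 * p)%N p1; rewrite leq_pmull// => /(_ isT).
rewrite natrM powRM ?ler0n// -ler_pdivlMl// ler_pdivrMr ?mulr_gt0 ?powR_gt0//.
move=> /le_trans; apply; rewrite -mulrA -mulrA ler_wpM2l ?invr_ge0 ?(ltW c0)//.
rewrite [leLHS](_ : _ = n.+1%:R `^ a * m p)// mulrACA.
by rewrite mulVf ?mulr1 1?mulrC// gt_eqF ?powR_gt0.
Qed.

(** The normalisation [b] serves two conditions: [b = k^alpha] for (iv) and [b = 1] for (v). *)
Lemma limn_esup_dilation_bound {R : realType} (m : nat -> R) (alpha b : R)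
    (k : nat) : (forall p, 0 < m p) -> (2 <= k)%N -> 0 < b ->
  (limn_esup (fun p : nat => (m (k * p)%N / (b * m p))%:E) <
    (k%:R `^ alpha / b)%:E)%E ->
  dilation_bound m alpha.
Proof.
move=> m0 k2 b0 /limf_esup_lt[r [rk [N _ HN]]]; exists k, (r * b); split => //.
  by rewrite -ltr_pdivlMr.
exists N => // p /HN/=; rewrite lee_fin ler_pdivrMr ?mulr_gt0//.
by rewrite mulrA.
Qed.

Lemma dilation_limn_esup {R : realType} (m : nat -> R) (alpha : R) :
  (forall p, 0 < m p) -> dilation_bound m alpha ->
  exists k : nat, (2 <= k)%N /\
    (limn_esup (fun p : nat => (m (k * p)%N / m p)%:E) < (k%:R `^ alpha)%:E)%E.
Proof.
move=> m0 [k [r [k2 rk [N _ HN]]]]; exists k; split => //.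
apply: (@le_lt_trans _ _ r%:E); last by rewrite lte_fin.
apply: limf_esup_le; exists N => // p /HN/= h.
by rewrite lee_fin ler_pdivrMr.
Qed.

(** * The power bound and conditions (ii), (iv) and (vi) *)

Lemma power_dilation {R : realType} (m : nat -> R) (a K : R) :
  (forall p, 0 < m p) -> 0 < a -> 0 < K ->
  (forall p q, (p <= q)%N -> m q * p.+1%:R `^ a <= K * (q.+1%:R `^ a * m p)) ->
  forall k p, (1 <= k)%N -> m (k * p)%N <= K * k%:R `^ a * m p.
Proof.
move=> m0 a0 K0 mK k p k1; have := mK p (k * p)%N; rewrite leq_pmull//.
move=> /(_ isT); rewrite -ler_pdivlMr ?powR_gt0// => /le_trans; apply.
rewrite ler_pdivrMr ?powR_gt0// -!mulrA ler_wpM2l ?(ltW K0)//.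
rewrite mulrCA mulrC ler_wpM2l ?(ltW (m0 _))//.
rewrite -powRM// ge0_ler_powR ?nnegrE ?mulr_ge0 ?(ltW a0)//.
by rewrite -natrM ler_nat mulnS -add1n leq_add2r.
Qed.

Lemma power_bound_almost_decreasing {R : realType} (m : nat -> R) (alpha : R) :
  (forall p, 0 < m p) -> power_bound m alpha ->
  exists eps : R, 0 < eps < alpha /\
    almost_decreasing (fun p : nat => m p / p%:R `^ (alpha - eps)).
Proof.
move=> m0 [a [K [/andP[a0 aalpha] K0 mK]]].
exists (alpha - a); rewrite subr_gt0 aalpha gtrBl a0; split => //.
(* The factor [2^a] removes the shift, through [q.+1 <= 2 q] for [q >= 1]. *)
exists (K * 2 `^ a)^-1; split; first by rewrite invr_gt0 mulr_gt0 ?powR_gt0.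
move=> p q p1 pq; rewrite subKr.
have p0 : (0 : R) < p%:R by rewrite ltr0n.
have q0 : (0 : R) < q%:R by rewrite ltr0n (leq_trans p1).
rewrite ler_pdivrMl ?mulr_gt0 ?powR_gt0//.
rewrite ler_pdivrMr ?powR_gt0// mulrA mulrAC ler_pdivlMr ?powR_gt0//.
apply: (@le_trans _ _ (m q * p.+1%:R `^ a)).
  rewrite ler_wpM2l ?(ltW (m0 _))//.
  by rewrite ge0_ler_powR ?nnegrE ?(ltW a0)// ler_nat.
apply: le_trans (mK _ _ pq) _.
rewrite -!mulrA ler_wpM2l ?(ltW K0)//.
rewrite [m p * _]mulrC mulrA ler_wpM2r ?(ltW (m0 _))// -powRM//.
rewrite ge0_ler_powR ?nnegrE ?mulr_ge0 ?(ltW a0)// -natrM ler_nat.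
by lia.
Qed.

(** For [k >= 1] the limit superior lies between 0 and [K / k^(alpha - a)]. *)
Lemma power_bound_limn_esup_cvg0 {R : realType} (m : nat -> R) (alpha : R) :
  (forall p, 0 < m p) -> power_bound m alpha ->
  (fun k : nat =>
     limn_esup (fun p : nat => (m (k * p)%N / (k%:R `^ alpha * m p))%:E))
    @ \oo --> (0 : \bar R).
Proof.
move=> m0 [a [K [/andP[a0 aalpha] K0 mK]]].
have d0 : 0 < alpha - a by rewrite subr_gt0.
pose g (k : nat) : R := K / k%:R `^ (alpha - a).
apply: (@squeeze_cvge _ _ _ _ (fun=> 0%E) _ (fun k => (g k)%:E)).
- exists 1%N => // k /= k1; have k0 : (0 : R) < k%:R by rewrite ltr0n.
  apply/andP; split.
    apply: limf_esup_ge0; first exact: filter_not_empty.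
    by move=> p; rewrite lee_fin divr_ge0 ?mulr_ge0 ?powR_ge0// ltW.
  apply: limf_esup_le; exists 0%N => // p _.
  rewrite lee_fin ler_pdivrMr ?mulr_gt0 ?powR_gt0//.
  apply: le_trans (power_dilation _ _ _ m0 a0 K0 mK _ _ k1) _.
  rewrite mulrA ler_wpM2r ?(ltW (m0 _))// /g powRB ?(lt0r_neq0 k0) ?implybT//.
  rewrite [leRHS](_ : _ = K * k%:R `^ a)//.
  by field; rewrite !gt_eqF ?powR_gt0.
- exact: cvg_cst.
- apply: cvg_EFin; first exact: nearW.
  apply/cvgr0Pnorm_lt => e e0 /=.
  have [N HN] := powR_gt_near _ (K / e) d0.
  exists N.+1 => // k /= Nk.
  have k0 : (0 : R) < k%:R by rewrite ltr0n (leq_trans _ Nk).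
  rewrite ger0_norm ?divr_ge0 ?powR_ge0 ?(ltW K0)//.
  by rewrite ltr_pdivrMr ?powR_gt0// mulrC -ltr_pdivrMr// HN// ltnW.
Qed.

Lemma cvg0_dilation_bound {R : realType} (m : nat -> R) (alpha : R) :
  (forall p, 0 < m p) ->
  (fun k : nat =>
     limn_esup (fun p : nat => (m (k * p)%N / (k%:R `^ alpha * m p))%:E))
    @ \oo --> (0 : \bar R) ->
  dilation_bound m alpha.
Proof.
move=> m0 mcvg.
(* A single [k >= 2] with limit superior below 1 suffices. *)
have /mcvg[N _ HN] : nbhs (0 : \bar R) [set y | (y < 1%:E)%E].
  by apply: open_nbhs_nbhs; split; [exact: open_ereal_lt_ereal|exact: lte01].
have := HN (maxn N 2) (leq_maxl _ _); set k := maxn N 2 => /= h.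
have k2 : (2 <= k)%N by exact: leq_maxr.
have k0 : (0 : R) < k%:R by rewrite ltr0n (leq_trans _ k2).
apply: (@limn_esup_dilation_bound _ _ _ (k%:R `^ alpha) k) => //.
  by rewrite powR_gt0.
by rewrite divff// gt_eqF ?powR_gt0.
Qed.

Lemma power_bound_uniform {R : realType} (m : nat -> R) (alpha theta : R) :
  (forall p, 0 < m p) -> power_bound m alpha -> 0 < theta ->
  exists k : nat, (2 <= k)%N /\
    forall p : nat, (1 <= p)%N -> m (k * p)%N <= theta * k%:R `^ alpha * m p.
Proof.
move=> m0 [a [K [/andP[a0 aalpha] K0 mK]]] theta0.
have d0 : 0 < alpha - a by rewrite subr_gt0.
have [N HN] := powR_gt_near _ (K / theta) d0.
exists (maxn N 2); rewrite leq_maxr; split => // p _.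
have := HN _ (leq_maxl N 2); set k := maxn N 2 => h.
have k2 : (2 <= k)%N by exact: leq_maxr.
have k0 : (0 : R) < k%:R by rewrite ltr0n (leq_trans _ k2).
apply: le_trans (power_dilation _ _ _ m0 a0 K0 mK _ _ (ltnW k2)) _.
rewrite ler_wpM2r ?(ltW (m0 _))// -ler_pdivlMr ?powR_gt0// -mulrA -powRB.
  by rewrite -ler_pdivrMl// mulrC ltW.
by rewrite (lt0r_neq0 k0) implybT.
Qed.

Lemma uniform_dilation_bound {R : realType} (m : nat -> R) (alpha : R) :
  (forall theta : R, 0 < theta < 1 -> exists k : nat, (2 <= k)%N /\
     forall p : nat, (1 <= p)%N -> m (k * p)%N <= theta * k%:R `^ alpha * m p) ->
  dilation_bound m alpha.
Proof.
have h2 : 0 < (2^-1 : R) < 1 by rewrite invr_gt0 ltr0n invf_lt1 ?ltr1n.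
move=> /(_ _ h2)[k [k2 mk]]; exists k, (2^-1 * k%:R `^ alpha); split => //.
  have k0 : (0 : R) < k%:R by rewrite ltr0n (leq_trans _ k2).
  by case/andP: h2 => _ h2; rewrite gtr_pMl ?powR_gt0.
by exists 1%N.
Qed.

(** * The upper Matuszewska index *)

Lemma power_bound_alpha_index {R : realType} (m : nat -> R) (alpha : R) :
  (forall p, 0 < m p) -> power_bound m alpha -> (alpha_index m < alpha%:E)%E.
Proof.
move=> m0 [a [K [/andP[a0 aalpha] K0 mK]]].
apply: (@le_lt_trans _ _ a%:E); last by rewrite lte_fin.
(* The exponent [a] itself is admissible in the infimum. The factor [2^a] absorbs rounding: with [n]
   the integer part of [x >= 1], [l x <= l (n + 1) <= 2 l n]. *)
apply: ereal_inf_lbound; exists a => //; exists (K * 2 `^ a).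
split; first by rewrite mulr_gt0 ?powR_gt0.
move=> L L1; apply: limf_esup_le; exists 1; split; first exact: num_real.
move=> x x1; apply: ge_ereal_sup => _ [l /= + <-].
rewrite in_itv/= => /andP[l1 _]; rewrite lee_fin /step_fun.
have l0 : 0 < l by rewrite (lt_le_trans ltr01).
have x0 : 0 < x by rewrite (lt_trans ltr01).
have lx0 : 0 <= l * x by rewrite ltW// mulr_gt0.
have n1 : (0 < Num.truncn x)%N by rewrite truncn_gt0 ltW.
have nq : (Num.truncn x <= Num.truncn (l * x))%N.
  by apply: le_truncn; rewrite ler_peMl// ltW.
rewrite ler_pdivrMr ?mulr_gt0 ?powR_gt0//.
have := mK (Num.truncn x).-1 (Num.truncn (l * x)).-1.
rewrite !prednK ?(leq_trans n1 nq)// => /(_ ltac:(lia)).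
set q := Num.truncn (l * x) in nq *; set n := Num.truncn x in n1 nq *.
have n0 : (0 : R) < n%:R by rewrite ltr0n.
rewrite -ler_pdivlMr ?powR_gt0// => /le_trans; apply.
rewrite ler_pdivrMr ?powR_gt0//.
rewrite [leRHS](_ : _ = K * ((2 * l * n%:R) `^ a * m n.-1)); last first.
  by rewrite !powRM ?mulr_ge0 ?(ltW l0) ?(ltW n0)//; ring.
rewrite ler_wpM2l ?(ltW K0)// ler_wpM2r ?(ltW (m0 _))//.
rewrite ge0_ler_powR ?nnegrE ?mulr_ge0 ?(ltW l0) ?(ltW n0) ?(ltW a0)//.
apply: (@le_trans _ _ (l * x)); first by rewrite truncn_le.
rewrite -mulrA mulrCA ler_wpM2l ?(ltW l0)// (le_trans (ltW (truncnS_gt x)))//.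
by rewrite -/n -natrM ler_nat; lia.
Qed.

Lemma alpha_index_dilation_bound {R : realType} (m : nat -> R) (alpha : R) :
  (forall p, 0 < m p) -> {homo m : p q / (p <= q)%N >-> p <= q} ->
  (alpha_index m < alpha%:E)%E -> dilation_bound m alpha.
Proof.
move=> m0 m_nd /ereal_inf_lt[_ [a [C [C0 HC]] <-]]; rewrite lte_fin => aalpha.
apply: (@cofinal_dilation_bound _ _ _ a (C + 1)) => // n.
exists n.+2; split; first by lia.
have k0 : (0 : R) < n.+2%:R by [].
have k1 : (1 : R) < n.+2%:R by rewrite ltr1n.
(* Enlarging [C] to [C + 1] makes the inequality strict, so that it holds eventually without the
   limit superior. *)
have : (limf_esup (fun x : R => ereal_sup
    [set (step_fun m (l * x) / (l `^ a * step_fun m x))%:E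
      | l in `[1%R, n.+2%:R]%classic]) (pinfty_nbhs R) < (C + 1)%:E)%E.
  by apply: le_lt_trans (HC _ k1) _; rewrite lte_fin ltrDl.
move=> /limf_esup_lt[r [rC [M [_ HM]]]].
have [N _ HN] := nbhs_infty_gtr M; exists N => // p Np.
have Mp : M < p.+1%:R.
  by rewrite (lt_trans (HN _ Np))// ltr_nat.
(* Taking [x = p.+1] and [l = k = n.+2], the step function gives [m p] and [m (k * p.+1 - 1)]; the
   latter dominates [m (k * p)]. *)
have : ((step_fun m (n.+2%:R * p.+1%:R) /
    (n.+2%:R `^ a * step_fun m p.+1%:R))%:E <= r%:E)%E.
  apply: le_trans (HM _ Mp); apply: ereal_sup_ubound; exists n.+2%:R => //=.
  by rewrite in_itv/= lexx ltW.
rewrite /step_fun -natrM !natrK lee_fin ler_pdivrMr ?mulr_gt0 ?powR_gt0//=.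
move=> h; apply: (@le_trans _ _ (m (n.+2 * p.+1).-1)); first by apply: m_nd; lia.
apply: (le_trans h); rewrite -mulrA ler_wpM2r ?mulr_ge0 ?powR_ge0 ?(ltW (m0 _))//.
exact: ltW.
Qed.

(** * Partial sums and tails: conditions (i) and (viii) *)

(** Bounding [1 / m k] through [m p] leaves the sum of [k.+1^(alpha - a - 1)], of order
    [p.+1^(alpha - a)] since [a < alpha]. *)
Lemma power_bound_sum {R : realType} (m : nat -> R) (alpha : R) :
  (forall p, 0 < m p) -> power_bound m alpha ->
  exists C : R, 0 < C /\ forall p : nat,
    \sum_(k < p.+1) (k.+1%:R `^ (alpha - 1) / m k)
      <= C * (p.+1%:R `^ alpha / m p).
Proof.
move=> m0 [a [K [/andP[a0 aalpha] K0 mK]]].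
have d0 : 0 < alpha - a by rewrite subr_gt0.
exists (K * ((1 + (alpha - a)) / (alpha - a))); split.
  by rewrite mulr_gt0// divr_gt0// addr_gt0.
move=> p; have p0 : (0 : R) < p.+1%:R by [].
apply: (@le_trans _ _ (\sum_(k < p.+1)
    K * (p.+1%:R `^ a / m p) * k.+1%:R `^ (alpha - a - 1))).
  apply: ler_sum => k _; have k0 : (0 : R) < k.+1%:R by [].
  have -> : k.+1%:R `^ (alpha - 1) = k.+1%:R `^ a * k.+1%:R `^ (alpha - a - 1) :> R.
    rewrite -powRD; first by congr (_ `^ _); ring.
    by rewrite (lt0r_neq0 k0) implybT.
  rewrite mulrAC ler_wpM2r ?powR_ge0// ler_pdivrMr// mulrA mulrAC.
  rewrite ler_pdivlMr// mulrC -mulrA; apply: mK.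
  by rewrite -ltnS.
rewrite -mulr_sumr -!mulrA ler_wpM2l ?(ltW K0)//.
apply: le_trans (ler_wpM2l _ (ler_wpM2l _ (sum_powR_le _ p d0))) _.
- by rewrite powR_ge0.
- by rewrite invr_ge0 ltW.
- rewrite powRB ?(lt0r_neq0 p0) ?implybT//.
  rewrite le_eqVlt; apply/orP; left; apply/eqP.
  by field; rewrite !gt_eqF ?powR_gt0.
Qed.

Lemma power_bound_tail {R : realType} (m : nat -> R) (alpha : R) :
  (forall p, 0 < m p) -> power_bound m alpha ->
  exists C : R, 0 < C /\ forall p : nat,
    (\sum_(p.+1 <= k <oo) (m k / k.+1%:R `^ (1 + alpha))%:E
      <= (C * (m p / p.+1%:R `^ alpha))%:E)%E.
Proof.
move=> m0 [a [K [/andP[a0 aalpha] K0 mK]]].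
have d0 : 0 < alpha - a by rewrite subr_gt0.
exists (K / (alpha - a)); split; first by rewrite divr_gt0.
move=> p; have p0 : (0 : R) < p.+1%:R by [].
apply: lime_le.
  apply: is_cvg_nneseries => k _ _.
  by rewrite lee_fin divr_ge0 ?powR_ge0// ltW.
apply: nearW => n; rewrite sumEFin lee_fin.
apply: (@le_trans _ _ (\sum_(p.+1 <= k < n)
    K * (m p / p.+1%:R `^ a) * k.+1%:R `^ (- (alpha - a) - 1))).
  apply: ler_sum_nat => k /andP[pk _]; have k0 : (0 : R) < k.+1%:R by [].
  have -> : - (alpha - a) - 1 = a - (1 + alpha) by ring.
  rewrite powRB ?(lt0r_neq0 k0) ?implybT// mulrA ler_wpM2r ?invr_ge0 ?powR_ge0//.
  rewrite [leRHS](_ : _ = K * (k.+1%:R `^ a * m p) / p.+1%:R `^ a); last by ring.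
  by rewrite ler_pdivlMr ?powR_gt0//; apply: mK; exact: ltnW.
rewrite -mulr_sumr -!mulrA ler_wpM2l ?(ltW K0)//.
rewrite [leRHS]mulrCA ler_wpM2l ?(ltW (m0 _))//.
apply: le_trans (ler_wpM2l _ (sum_powRN_le _ p n d0)) _.
  by rewrite invr_ge0 powR_ge0.
rewrite opprB powRB ?(lt0r_neq0 p0) ?implybT//.
rewrite le_eqVlt; apply/orP; left; apply/eqP.
by field; rewrite !gt_eqF ?powR_gt0.
Qed.

Lemma tail_decaying_equiv {R : realType} (m : nat -> R) (alpha C : R) :
  (forall p, 0 < m p) -> {homo m : p q / (p <= q)%N >-> p <= q} ->
  0 < alpha -> 0 < C ->
  (forall p : nat, (\sum_(p.+1 <= k <oo) (m k / k.+1%:R `^ (1 + alpha))%:E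
    <= (C * (m p / p.+1%:R `^ alpha))%:E)%E) ->
  decaying_equiv m alpha.
Proof.
move=> m0 m_nd alpha0 C0 mC.
have alpha10 : 0 < 1 + alpha by rewrite addr_gt0.
pose t k := m k / k.+1%:R `^ (1 + alpha).
have t0 k : 0 < t k by rewrite divr_gt0 ?powR_gt0.
pose E p := (\sum_(p.+1 <= k <oo) (t k)%:E)%E.
have tE0 k : (0 <= (t k)%:E)%E by rewrite lee_fin ltW.
have partial p n : ((\sum_(p.+1 <= k < n) t k)%:E <= E p)%E.
  by rewrite -sumEFin; apply: nneseries_lim_ge => k _ _.
have Efin p : E p \is a fin_num.
  rewrite ge0_fin_numE; first exact: le_lt_trans (mC p) (ltry _).
  by apply: le_trans (partial p p.+1); rewrite big_geq.
pose T p := fine (E p).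
have TE p : (T p)%:E = E p by rewrite fineK.
have Tpartial p n : \sum_(p.+1 <= k < n) t k <= T p by rewrite -lee_fin TE.
have TC p : T p <= C * (m p / p.+1%:R `^ alpha) by rewrite -lee_fin TE; exact: mC.
have TS p : T p = t p.+1 + T p.+1.
  apply/EFin_inj; rewrite EFinD !TE /E.
  rewrite (nneseries_split p.+1 1)//; first by rewrite addn1 big_nat1.
have T0 p : 0 < T p.
  by apply: lt_le_trans (Tpartial p p.+2); rewrite big_nat1.
(* The [p.+1] terms with [p < k < 2 * p.+1] already give a tail comparable to [m p / p.+1^alpha]. *)
have tlow p k : (p < k)%N -> (k < 2 * p.+1)%N ->
    m p / (2 * p.+1%:R) `^ (1 + alpha) <= t k.
  move=> pk kp; rewrite ler_pM ?invr_ge0 ?powR_ge0 ?(ltW (m0 _))//.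
    by rewrite m_nd// ltnW.
  rewrite lef_pV2 ?posrE ?powR_gt0 ?mulr_gt0//.
  rewrite ge0_ler_powR ?nnegrE ?mulr_ge0 ?(ltW alpha10)//.
  by rewrite -natrM ler_nat.
exists T, (C^-1 / 2 `^ alpha), C^-1, (2 `^ (1 + alpha)).
split; rewrite ?mulr_gt0 ?invr_gt0 ?powR_gt0// => p.
have p1 : (0 : R) < p.+1%:R by [].
split => //.
(* The term [t p.+1] removed from the tail is a definite fraction of [T p]: the hypothesis bounds
   [T p] by [C m p / p.+1^alpha], and [m p <= m p.+1] with [p.+2 <= 2 * p.+1] yields the factor
   [2^alpha]. *)
- suff : T p * (C^-1 / 2 `^ alpha / p.+2%:R) <= t p.+1.
    move=> le_t; rewrite [leRHS]mulrC mulrBr mulr1 lerBrDr.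
    by rewrite [leRHS]TS [leRHS]addrC lerD2l.
  have TCV : T p / C <= m p / p.+1%:R `^ alpha.
    by rewrite ler_pdivrMr// mulrC.
  rewrite !mulrA; apply: (@le_trans _ _
    (m p / p.+1%:R `^ alpha / 2 `^ alpha / p.+2%:R)).
    by rewrite !ler_wpM2r ?invr_ge0 ?powR_ge0.
  rewrite -!mulrA ler_pM ?mulr_ge0 ?invr_ge0 ?powR_ge0 ?(ltW (m0 _))//.
    exact: m_nd.
  rewrite -!invfM lef_pV2 ?posrE ?mulr_gt0 ?powR_gt0//.
  rewrite powRD ?(gt_eqF alpha10)// powRr1// mulrC mulrA ler_wpM2r// -powRM//.
  rewrite ge0_ler_powR ?nnegrE ?mulr_ge0 ?(ltW alpha0)//.
  by rewrite -natrM ler_nat; lia.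
- by rewrite ler_pdivrMl.
- apply: (@le_trans _ _ (2 `^ (1 + alpha) *
      \sum_(p.+1 <= k < 2 * p.+1) t k)); last first.
    by rewrite ler_wpM2l ?powR_ge0.
  apply: (@le_trans _ _ (2 `^ (1 + alpha) *
      \sum_(p.+1 <= k < 2 * p.+1) m p / (2 * p.+1%:R) `^ (1 + alpha))).
    rewrite sumr_const_nat.
    have -> : (2 * p.+1 - p.+1)%N = p.+1 by lia.
    rewrite powRM// [p.+1%:R `^ (1 + alpha)]powRD ?(gt_eqF alpha10)// powRr1//.
    rewrite -mulr_natr le_eqVlt; apply/orP; left; apply/eqP.
    by field; rewrite !gt_eqF ?powR_gt0.
  rewrite ler_wpM2l ?powR_ge0//; apply: ler_sum_nat => k /andP[pk kp].
  exact: tlow.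
Qed.

(** * Quotients of a weight sequence and the equivalence *)

Lemma quot_gt0 {R : realType} (M : nat -> R) : weight_seq M ->
  forall p, 0 < quot M p.
Proof. by case=> _ M0 _ _ p; rewrite divr_gt0. Qed.

Lemma quot_nondecreasing {R : realType} (M : nat -> R) : weight_seq M ->
  {homo quot M : p q / (p <= q)%N >-> p <= q}.
Proof.
case=> _ M0 M_logconvex _; apply/nondecreasing_seqP => p; rewrite /quot.
rewrite ler_pdivrMr// mulrAC ler_pdivlMr// mulrC -expr2 mulrC.
exact: (M_logconvex p.+1).
Qed.

Theorem theorem3p16 (R : realType) (M : nat -> R) (alpha : R) :
  weight_seq M -> 0 < alpha ->
  let m := quot M in
  [<->
   (* (i) *)
   (exists C : R, 0 < C /\ forall p : nat,
      \sum_(k < p.+1) ((k.+1)%:R `^ (alpha - 1) / m k)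
        <= C * ((p.+1)%:R `^ alpha / m p));
   (* (ii) *)
   (exists eps : R, 0 < eps < alpha /\
      almost_decreasing (fun p : nat => m p / (p%:R `^ (alpha - eps))));
   (* (iii) *)
   (exists h : nat -> R, seq_equiv h m /\
      (forall p : nat, (p.+2)%:R `^ (- alpha) * h p.+1
                       <= (p.+1)%:R `^ (- alpha) * h p) /\
      (ereal_sup [set (h (2 * p)%N / h p)%:E | p in [set p : nat | (1 <= p)%N]]
        < (2 `^ alpha)%:E)%E);
   (* (iv) *)
   ((fun k : nat =>
       limn_esup (fun p : nat => (m (k * p)%N / (k%:R `^ alpha * m p))%:E))
      @ \oo --> (0 : \bar R));
   (* (v) *)
   (exists k : nat, (2 <= k)%N /\
      (limn_esup (fun p : nat => (m (k * p)%N / m p)%:E) < (k%:R `^ alpha)%:E)%E);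
   (* (vi) *)
   (forall theta : R, 0 < theta < 1 -> exists k : nat, (2 <= k)%N /\
      forall p : nat, (1 <= p)%N -> m (k * p)%N <= theta * k%:R `^ alpha * m p);
   (* (vii) *)
   (alpha_index m < alpha%:E)%E;
   (* (viii) *)
   (exists C : R, 0 < C /\ forall p : nat,
      (\sum_(p.+1 <= k <oo) (m k / (k.+1)%:R `^ (1 + alpha))%:E
        <= (C * (m p / (p.+1)%:R `^ alpha))%:E)%E)
  ].
Proof.
move=> wM alpha0 m.
have m0 := quot_gt0 _ wM : forall p, 0 < m p.
have m_nd := quot_nondecreasing _ wM : {homo m : p q / (p <= q)%N >-> p <= q}.
have dilation_power := dilation_power_bound _ _ m0 m_nd alpha0.
have sum_equiv (C : R) := sum_decaying_equiv m _ C m0 m_nd alpha0.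
(* The implications run cyclically from (i) to (viii) and back to (i). *)
tfae.
- move=> [C [C0 /(sum_equiv C C0)/(decaying_dilation_bound _ _ m0 alpha0)]].
  move=> /dilation_power; exact: power_bound_almost_decreasing.
(* The step from (ii) to (iii) passes through (i), whose partial sums supply the sequence [h]. *)
- move=> [eps [/andP[eps0 _]]].
  move=> /(almost_decreasing_dilation_bound m alpha _ m0).
  rewrite gtrBl eps0 => /(_ isT)/dilation_power/(power_bound_sum _ _ m0).
  move=> [C [C0 /(sum_equiv C C0)]]; exact: decaying_comparison.
- move=> [h [hm [_ /(comparison_dilation_bound _ _ _ m0 hm)]]].
  by move=> /dilation_power/(power_bound_limn_esup_cvg0 _ _ m0).
- move=> /(cvg0_dilation_bound _ _ m0); exact: dilation_limn_esup.
- move=> [k [k2 mk]] theta /andP[theta0 _].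
  apply: power_bound_uniform => //; apply: dilation_power.
  apply: (@limn_esup_dilation_bound _ _ _ 1 k) => //.
  by under eq_fun do rewrite mul1r; rewrite divr1.
- move=> /uniform_dilation_bound/dilation_power.
  exact: power_bound_alpha_index.
- move=> /(alpha_index_dilation_bound _ _ m0 m_nd)/dilation_power.
  exact: power_bound_tail.
- move=> [C [C0 /(tail_decaying_equiv _ _ C m0 m_nd alpha0 C0)]].
  move=> /(decaying_dilation_bound _ _ m0 alpha0)/dilation_power.
  exact: power_bound_sum.
Qed.
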